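(* Consider the $(\mathsf H,r,M,N)$ combination network with end-user-caches where $N\ge K=\binom{\mathsf H}{r}$, $0\le M\le N$. Let $R^\star_{\mathrm u}(M)$ be the optimal max-link load under uncoded cache placement and let $R_{\mathrm{cut}}(M)\le R^\star_{\mathrm u}(M)$ be the cut-set converse bound under uncoded placement. 1. Let $M=\frac{Nt}{K}$ with $t\in[0,K]$ real. The load at memory $M$ obtained by memory-sharing among the points of the DIS and the points of the baseline scheme (with loads $R_{\mathrm{DIS}}[\cdot]$ and $R_{\mathrm{base}}[\cdot]$) is at most $\min\{\mathsf H/r,\ \lceil t\rceil+1\}\cdot R_{\mathrm{cut}}(M)$. 2. Let $M=\frac{tN}{K}$ with $t\in[0,K]$ real. The load of the CICS at memory $M$ is at most $\left(1+\lceil t\rceil/r\right)\cdot R_{\mathrm{cut}}(M)$. 3. If $M\le\frac{rN}{K}$, the CICS is order optimal under the constraint of uncoded cache placement within a factor of $2$: its load at memory $M$ is at most $2R^\star_{\mathrm u}(M)$. 4. If $\mathsf H>2r$, $M\le\frac NK$, and $2r-1=p^v$ or $2r-1=pq$ with $p,q$ different primes and $v$ a positive integer, the IES is order optimal under the constraint of uncoded cache placement within a factor of $\frac{2r}{2r-1}\le\frac43$: its load at memory $M$ is at most $\frac{2r}{2r-1}R^\star_{\mathrm u}(M)$.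
   Context: Notation: $[n]=\{1,\dots,n\}$; $\binom ab=0$ if $a<b$. Network. An $(\mathsf H,r,M,N)$ combination network with end-user-caches ($1\le r\le\mathsf H$, $0\le M\le N$) has one server with $N$ files $F_1,\dots,F_N$, each consisting of $B$ independent uniform bits (files mutually independent), $\mathsf H$ relays without caches, and $K=\binom{\mathsf H}{r}$ users, each connected to a distinct $r$-subset of the relays. The server is connected to every relay. All links are error-free and interference-free. $\mathcal U_h\subseteq[K]$ is the set of users connected to relay $h$, $\mathcal H_k\subseteq[\mathsf H]$ the set of relays connected to user $k$, and $\mathcal R_{\mathcal W}=\{h\in[\mathsf H]:\mathcal W\subseteq\mathcal U_h\}$ for $\mathcal W\subseteq[K]$. Scheme. In the placement phase user $k$ stores a content $Z_k$ of at most $MB$ bits (a function of the files) without knowing the demands. The placement is uncoded if each $Z_k$ consists of bits copied directly from the files. In the delivery phase user $k$ demands $F_{d_k}$, $d_k\in[N]$; the demand vector $\mathbf d$ is known to all nodes. The server sends to relay $h$ a message $X_h$ of $B R_h(\mathbf d)$ bits, and relay $h$ sends to each user $k\in\mathcal U_h$ a message $X_{h\to k}$ (a function of $X_h$) of $B R_{h\to k}(\mathbf d)$ bits. User $k$ must recover $F_{d_k}$ from $Z_k$ and $(X_{h\to k}:h\in\mathcal H_k)$ with high probability. The max-link load of a scheme is $\max_{h,\,k\in\mathcal U_h,\,\mathbf d\in[N]^K}\max\{R_h(\mathbf d),R_{h\to k}(\mathbf d)\}$. A load $R$ is achievable for memory $M$ if there is a sequence of schemes with file sizes $B\to\infty$,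 error probability tending to $0$ and max-link load with limsup at most $R$. $R^\star_{\mathrm u}(M)$ is the minimum load achievable with uncoded placement. Cut-set converse bound under uncoded placement: $R_{\mathrm{cut}}(M)=\max_{x\in\{r,\dots,\mathsf H\}}\rho_x(M)$, where $\rho_x$ is the lower convex envelope of the points $$\left(t\frac{N}{\binom xr},\ \frac1x\cdot\frac{\binom{\binom xr}{t+1}-\binom{\max\{\binom xr-N,0\}}{t+1}}{\binom{\binom xr}{t}}\right),\qquad t\in\{0,\dots,\tbinom xr\}.$$ Schemes and their loads at memory $M=Nt/K$, $t\in\{0,\dots,K\}$ (at other memories memory-sharing is used, i.e. the load is the lower convex envelope of the points): DIS: $$R_{\mathrm{DIS}}[t]=\frac{|\mathcal V_1|+\sum_{\mathcal J\in\mathcal V_2}\frac1r|\{h\in[\mathsf H]:\mathcal U_h\cap\mathcal J\ne\emptyset\}|}{\mathsf H\binom Kt},$$ where $\mathcal V_1$ (resp. $\mathcal V_2$) is the family of $\mathcal J\subseteq[K]$, $|\mathcal J|=t+1$, with $\mathcal R_{\mathcal J}\ne\emptyset$ (resp. $=\emptyset$). Baseline scheme (from prior work): $R_{\mathrm{base}}[t]=\min\left\{\frac{K(1-M/N)}{\mathsf H},\frac{K(1-M/N)}{r(1+KM/N)}\right\}$ with $M=Nt/K$. CICS: $$R_{\mathrm{CICS}}[t]=\sum_{\mathcal J\subseteq[K]:|\mathcal J|=t+1}\frac{1+\min_{h\in[\mathsf H]}|\mathcal J\setminus\mathcal U_h|/r}{\mathsf H\binom Kt}.$$ IES (only for $t\in\{0,1\}$):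 load $K/\mathsf H$ at $M=0$, and at $M=N/K$ load $$R_{\mathrm{IES}}=\frac1{2\mathsf H}\left(K-1-\binom{\mathsf H-r}{r}\right)+\frac{\binom{2r-1}{r-1}}{(2r-1)K}\binom{\mathsf H-1}{2r-1}.$$ *)

(* Defs.v *)
From HB Require Import structures.
From mathcomp Require Import all_boot all_order all_algebra.
From mathcomp Require Import boolp classical_sets reals ereal topology.
From mathcomp Require Import normedtype sequences.
Set Implicit Arguments.
Unset Strict Implicit.
Unset Printing Implicit Defensive.
Import Order.TTheory GRing.Theory Num.Theory.
Import numFieldNormedType.Exports.
Local Open Scope ring_scope.

(** * The combination network

    A user is identified with the r-subset of relays it is connected to, so
    that there are [K = 'C(H, r)] users; for [k : user H r], [val k] is
    the set H_k of the relays connected to [k]. *)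
Definition user (H r : nat) := {A : {set 'I_H} | #|A| == r}.

Definition usersOf (H r : nat) (h : 'I_H) : {set user H r} :=
  [set k : user H r | h \in val k].

Definition relaysOf (H r : nat) (W : {set user H r}) : {set 'I_H} :=
  [set h : 'I_H | W \subset usersOf r h].

Definition files (N B : nat) := {ffun 'I_N -> B.-tuple bool}.

Definition demand (H r N : nat) := {ffun user H r -> 'I_N}.

(** A caching scheme for files of [B] bits. The cache contents do not depend on
    the demand; the demand is known to all nodes in the delivery phase. All
    lengths are in bits: B R_h(d) is [relay_bits d h] and B R_{h->k}(d) is
    [link_bits d h k]. The values of [link_bits] and [link_msg] at unconnected
    pairs (h, k) are junk: they are neither decoded from nor counted. *)
Record scheme (H r N B : nat) := Scheme {
  cache_bits : user H r -> nat;
  cache : forall k : user H r, files N B -> (cache_bits k).-tuple bool;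
  relay_bits : demand H r N -> 'I_H -> nat;
  relay_msg : forall (d : demand H r N) (h : 'I_H),
    files N B -> (relay_bits d h).-tuple bool;
  link_bits : demand H r N -> 'I_H -> user H r -> nat;
  link_msg : forall (d : demand H r N) (h : 'I_H) (k : user H r),
    (relay_bits d h).-tuple bool -> (link_bits d h k).-tuple bool;
  decode : forall (d : demand H r N) (k : user H r),
    (cache_bits k).-tuple bool ->
    (forall h : 'I_H, h \in val k -> (link_bits d h k).-tuple bool) ->
    B.-tuple bool
}.

Definition uncoded (H r N B : nat) (S : scheme H r N B) : Prop :=
  forall (k : user H r) (j : 'I_(cache_bits S k)),
  exists (i : 'I_N) (b : 'I_B),
  forall F : files N B, tnth (cache S k F) j = tnth (F i) b.

Definition decoded (H r N B : nat) (S : scheme H r N B)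
    (d : demand H r N) (F : files N B) (k : user H r) : B.-tuple bool :=
  @decode _ _ _ _ S d k (cache S k F)
    (fun h _ => @link_msg _ _ _ _ S d h k (relay_msg S d h F)).

(** Worst case over the demands of the probability that some user fails to
    recover its file, under the uniform distribution on [files N B] (i.e. all
    bits of all files are independent and uniform). *)
Definition error_prob (R : realType) (H r N B : nat) (S : scheme H r N B) : R :=
  \big[Num.max/0]_(d : demand H r N)
    (#|[set F : files N B | [exists k, decoded S d F k != F (d k)]]|%:R
     / #|{: files N B}|%:R).

Definition max_link_load (R : realType) (H r N B : nat)
    (S : scheme H r N B) : R :=
  (\max_(d : demand H r N) \max_(h < H) \max_(k in usersOf r h)
     maxn (relay_bits S d h) (link_bits S d h k))%:R / B%:R.

Definition achievable_uncoded (R : realType) (H r N : nat) (M L : R) : Prop :=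
  exists (B : nat -> nat) (S : forall i : nat, scheme H r N (B i)),
  [/\ (B i @[i --> \oo] --> \oo)%classic,
      forall i, uncoded (S i),
      forall i (k : user H r), (cache_bits (S i) k)%:R <= M * (B i)%:R,
      (error_prob R (S i) @[i --> \oo] --> (0 : R))%classic &
      (limn_esup (fun i => (max_link_load R (S i))%:E) <= L%:E)%E].

Definition Rstar_u (R : realType) (H r N : nat) (M : R) : R :=
  inf [set L | achievable_uncoded H r N M L]%classic.

(** * Lower convex envelopes (memory-sharing)

    The value at [x] of the lower convex envelope of the points
    [(px i, py i)], for [x] between the least and the greatest [px i]. *)
Definition lower_envelope (R : realType) (I : finType) (px py : I -> R)
    (x : R) : R :=
  inf [set y : R | exists w : I -> R,
         [/\ forall i, 0 <= w i, \sum_i w i = 1,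
             \sum_i w i * px i = x & \sum_i w i * py i = y]]%classic.

(** * The cut-set converse bound *)

Definition rho (R : realType) (r N x : nat) (M : R) : R :=
  lower_envelope
    (fun t : 'I_('C(x, r)).+1 => t%:R * (N%:R / 'C(x, r)%:R))
    (fun t : 'I_('C(x, r)).+1 =>
       x%:R^-1 * (('C('C(x, r), t.+1)%:R - 'C(('C(x, r) - N)%N, t.+1)%:R)
                  / 'C('C(x, r), t)%:R))
    M.

(** The default value [rho r N r M] is the term of index [x = r]. *)
Definition Rcut (R : realType) (H r N : nat) (M : R) : R :=
  \big[Num.max/rho r N r M]_(r <= x < H.+1) rho r N x M.

(** * Loads of the schemes *)

Definition mem_point (R : realType) (H r N : nat) (t : nat) : R :=
  N%:R * t%:R / 'C(H, r)%:R.

Definition V1 (H r t : nat) : {set {set user H r}} :=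
  [set J : {set user H r} | (#|J| == t.+1) && (relaysOf J != finset.set0)].

Definition V2 (H r t : nat) : {set {set user H r}} :=
  [set J : {set user H r} | (#|J| == t.+1) && (relaysOf J == finset.set0)].

Definition R_DIS (R : realType) (H r t : nat) : R :=
  (#|V1 H r t|%:R
   + \sum_(J in V2 H r t)
       r%:R^-1 * #|[set h : 'I_H | usersOf r h :&: J != finset.set0]|%:R)
  / (H%:R * 'C('C(H, r), t)%:R).

Definition R_base (R : realType) (H r N t : nat) : R :=
  let K : R := 'C(H, r)%:R in
  let M : R := mem_point R H r N t in
  Num.min (K * (1 - M / N%:R) / H%:R)
          (K * (1 - M / N%:R) / (r%:R * (1 + K * M / N%:R))).

(** [#|J|] bounds every term, so for [0 < H] it does not affect the minimum. *)
Definition R_CICS (R : realType) (H r t : nat) : R :=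
  \sum_(J : {set user H r} | #|J| == t.+1)
     (1 + (\big[minn/#|J|]_(h < H) #|J :\: usersOf r h|)%:R / r%:R)
     / (H%:R * 'C('C(H, r), t)%:R).

Definition R_IES (R : realType) (H r : nat) : R :=
  (2 * H%:R)^-1 * ('C(H, r)%:R - 1 - 'C((H - r)%N, r)%:R)
  + 'C((2 * r - 1)%N, (r - 1)%N)%:R / ((2 * r%:R - 1) * 'C(H, r)%:R)
    * 'C((H - 1)%N, (2 * r - 1)%N)%:R.

(** Memory-sharing among the points of both schemes: [inl t] is the point [t] of
    DIS and [inr t] the point [t] of the baseline scheme. *)
Definition load_DIS_base (R : realType) (H r N : nat) (M : R) : R :=
  lower_envelope
    (fun i : 'I_('C(H, r)).+1 + 'I_('C(H, r)).+1 =>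
       match i with inl t | inr t => mem_point R H r N t end)
    (fun i : 'I_('C(H, r)).+1 + 'I_('C(H, r)).+1 =>
       match i with inl t => R_DIS R H r t | inr t => R_base R H r N t end)
    M.

Definition load_CICS (R : realType) (H r N : nat) (M : R) : R :=
  lower_envelope
    (fun t : 'I_('C(H, r)).+1 => mem_point R H r N t)
    (fun t : 'I_('C(H, r)).+1 => R_CICS R H r t)
    M.

(** The two points are [M = 0] (index [false]) and [M = N/K] (index [true]). *)
Definition load_IES (R : realType) (H r N : nat) (M : R) : R :=
  lower_envelope
    (fun b : bool => if b then N%:R / 'C(H, r)%:R else 0)
    (fun b : bool => if b then R_IES R H r else 'C(H, r)%:R / H%:R)
    M.

(* Main.v *)
(** Lower bound. Serve the users one after the other in some order and call a
    bit fresh if some user demands it and neither that user nor any earlier one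
    has cached it. The relay messages and the non-fresh bits determine all the
    files, so there are at most [H R B] fresh bits, up to one bit paying for the
    decoding errors. Averaging over all orders of the users and all cyclic shifts
    of a demand of distinct files, a bit cached by [c] of the [K] users is fresh
    with weight [f c = (K - c) / (c + 1)]; as [f] is convex and decreasing,
    [H R] is at least the piecewise linear interpolation of [f] at [K M / N]. The
    same interpolation, divided by [H], is below the term [x = H] of [Rcut].

    Upper bounds. At every integer point [t], each of the three loads is at most
    its claimed factor times [f t / H]. *)
Require Import Defs.
From HB Require Import structures.
From mathcomp Require Import all_boot all_order all_algebra.
From mathcomp Require Import fingroup perm zify ring lra.
From mathcomp Require Import boolp classical_sets reals ereal topology.
From mathcomp Require Import normedtype sequences.
Set Implicit Arguments.
Unset Strict Implicit.
Unset Printing Implicit Defensive.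
Import Order.TTheory GRing.Theory Num.Theory.
Import numFieldNormedType.Exports.
Local Open Scope ring_scope.

(** * Lower convex envelopes *)

Section LowerEnvelope.
Context (R : realType) (I : finType) (px py : I -> R).

Definition mixtures (x : R) : set R :=
  [set y : R | exists w : I -> R,
     [/\ forall i, 0 <= w i, \sum_i w i = 1,
         \sum_i w i * px i = x & \sum_i w i * py i = y]]%classic.

Lemma mixture2 (i j : I) (a : R) : 0 <= a <= 1 ->
  mixtures (px i + a * (px j - px i)) (py i + a * (py j - py i)).
Proof.
move=> /andP[a0 a1].
have sum1 (k : I) (f : I -> R) : \sum_l (l == k)%:R * f l = f k.
  rewrite (bigD1 k) //= eqxx mul1r big1 ?addr0 // => l /negPf ->.
  by rewrite mul0r.
have sumw (f : I -> R) :
    \sum_l ((1 - a) * (l == i)%:R + a * (l == j)%:R) * f l =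
    f i + a * (f j - f i).
  under eq_bigr do rewrite mulrDl -!mulrA.
  by rewrite big_split -!mulr_sumr /= !sum1; ring.
exists (fun l => (1 - a) * (l == i)%:R + a * (l == j)%:R); split => //.
  by move=> l; rewrite addr_ge0 // mulr_ge0 ?ler0n ?subr_ge0.
by have := sumw (fun=> 1); under eq_bigr do rewrite mulr1; move=> ->; ring.
Qed.

Lemma lower_envelope_le2 (i j : I) (a : R) : 0 <= a <= 1 ->
  lower_envelope px py (px i + a * (px j - px i)) <= py i + a * (py j - py i).
Proof.
move=> /(mixture2 i j) mix; apply: ge_inf mix.
(* [ge_inf] asks for some lower bound of the set of mixtures; this one works because all weights are
   at most 1. *)
exists (- \sum_k `|py k|) => y [w [w0 w1 _ <-]].
rewrite -sumrN ler_sum // => k _.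
have wk1 : w k <= 1.
  by rewrite -w1 (bigD1 k) //= lerDl sumr_ge0.
rewrite lerNl -mulrN (le_trans (ler_norm _)) // normrM normrN ger0_norm //.
by rewrite ler_piMl.
Qed.

(** As weights sum to 1, an affine minorant of the points is a minorant of every mixture.
    Nonemptiness matters because [inf] of the empty set is a default value. *)
Lemma lower_envelope_ge (u v x : R) : (mixtures x !=set0)%classic ->
  (forall i, u + v * px i <= py i) -> u + v * x <= lower_envelope px py x.
Proof.
move=> mix le_py; apply: lb_le_inf => // y [w [w0 w1 wx wy]].
rewrite -wx -wy -[u]mulr1 -w1 !mulr_sumr -big_split ler_sum //= => i _.
by rewrite [u * _]mulrC mulrCA -mulrDr ler_wpM2l.
Qed.

End LowerEnvelope.

(** * The function [f] of the lower bound and its chords *)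

Section MaddahAliNiesen.
Context (R : realType) (K : nat).

(* The load of the Maddah-Ali--Niesen scheme for [K] users whose caches
   replicate every file [c] times. *)
Definition mn_load (c : nat) : R := (K%:R - c%:R) / c.+1%:R.

Definition mn_slope (m : nat) : R := mn_load m.+1 - mn_load m.

(** A full line rather than a segment: it is also evaluated at integers outside [[m, m + 1]]. *)
Definition mn_chord (m : nat) (t : R) : R :=
  mn_load m + (t - m%:R) * mn_slope m.

Lemma mn_load_binom (c : nat) : (c <= K)%N ->
  'C(K, c.+1)%:R / 'C(K, c)%:R = mn_load c.
Proof.
move=> cK; apply/eqP.
rewrite eqr_div ?pnatr_eq0 // -?lt0n ?bin_gt0 //.
by rewrite mulrC -natrM mul_bin_left natrM natrB.
Qed.

Lemma mn_slopeE (m : nat) :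
  mn_slope m = - (K.+1%:R / (m.+1%:R * m.+2%:R)).
Proof.
rewrite /mn_slope /mn_load.
have m1 : m%:R + 1 != 0 :> R by rewrite natr1 pnatr_eq0.
have m2 : m%:R + 1 + 1 != 0 :> R by rewrite !natr1 pnatr_eq0.
by rewrite -!natr1; field; rewrite m1 m2.
Qed.

Lemma mn_slope_le0 (m : nat) : mn_slope m <= 0.
Proof. by rewrite mn_slopeE oppr_le0 divr_ge0 // -natrM. Qed.

(** The gap is a nonnegative factor times [(c - m) * (c - m - 1)], a product of two consecutive
    integers. *)
Lemma mn_chord_le (m c : nat) : mn_chord m c%:R <= mn_load c.
Proof.
rewrite -subr_ge0 /mn_chord mn_slopeE /mn_load.
have c1 : c%:R + 1 != 0 :> R by rewrite natr1 pnatr_eq0.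
have m1 : m%:R + 1 != 0 :> R by rewrite natr1 pnatr_eq0.
have m2 : m%:R + 2 != 0 :> R by rewrite -natrD pnatr_eq0 addn2.
rewrite -!natr1 [X in 0 <= X](_ : _ = (K%:R + 1) *
  ((c%:R - m%:R) * (c%:R - m%:R - 1))
  / ((c%:R + 1) * (m%:R + 1) * (m%:R + 2))); last first.
  by field; rewrite c1 m1 m2.
apply: divr_ge0; last by rewrite !mulr_ge0 // addr_ge0.
apply: mulr_ge0; first by rewrite addr_ge0.
case: (leqP c m) => [cm | mc].
  have : c%:R <= m%:R :> R by rewrite ler_nat.
  by move=> ?; apply: mulr_le0; lra.
have : m%:R + 1 <= c%:R :> R by rewrite natr1 ler_nat.
by move=> ?; apply: mulr_ge0; lra.
Qed.

Lemma unit_interval_exists (t : R) : (0 < K)%N -> 0 <= t <= K%:R ->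
  exists m : nat, [/\ (m < K)%N, m%:R <= t & t <= m.+1%:R].
Proof.
move=> K0 /andP[t0 tK].
have [tltK|] := boolP (t < K%:R).
  have /andP[mt tm] := truncn_itv t0.
  exists (Num.truncn t); split => //; last exact: ltW.
  by rewrite -(ltr_nat R) (le_lt_trans mt).
(* At [t = K] the truncation would be [K]; stepping back by one keeps [m + 1] a valid index. *)
rewrite -leNgt => Kt; exists K.-1; rewrite prednK //; split=> //.
by rewrite (le_trans _ Kt) // ler_nat leq_pred.
Qed.

End MaddahAliNiesen.

(** * Loads of the schemes at integer points *)

Lemma leq_bigmin_seq (I : eqType) (s : seq I) (F : I -> nat) (x : nat) (j : I) :
  j \in s -> (\big[minn/x]_(i <- s) F i <= F j)%N.
Proof.
elim: s => // i s IHs; rewrite inE big_cons => /predU1P[-> | /IHs le_s].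
  exact: geq_minl.
exact: leq_trans (geq_minr _ _) le_s.
Qed.

(** Both sides count the [k]-subsets of [m]-subsets of an [n]-set; multiplied by the three
    factorials below, each becomes [n!]. *)
Lemma bin_mul_bin (n m k : nat) : (k <= m <= n)%N ->
  ('C(n, m) * 'C(m, k) = 'C(n, k) * 'C(n - k, m - k))%N.
Proof.
case/andP=> km mn; have kn := leq_trans km mn.
apply/eqP; rewrite -(eqn_pmul2r (_ : 0 < k`! * (m - k)`! * (n - m)`!)%N); last first.
  by rewrite !muln_gt0 !fact_gt0.
have e1 := bin_fact mn; have e2 := bin_fact km; have e3 := bin_fact kn.
have e4 := bin_fact (leq_sub2r k mn); rewrite subnBA // subnK // in e4.
apply/eqP; transitivity n`!.
  by rewrite -e1 -e2; ring.
by rewrite -e3 -e4; ring.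
Qed.

Section SchemeLoads.
Context (R : realType) (H r : nat).
Hypotheses (r_gt0 : (0 < r)%N) (r_le : (r <= H)%N).
Let K := 'C(H, r).

Lemma card_user : #|{: user H r}| = K.
Proof.
have := card_draws 'I_H r; rewrite card_ord -/K => <-.
by rewrite card_sig; apply: eq_card => A; rewrite !inE.
Qed.

(** A set in [V1] costs 1. A set [J] in [V2] costs [1 / r] per relay it meets; there are at most [H]
    such relays, and at most [(t + 1) * r], since each of its [t + 1] users has [r] relays. *)
Lemma R_DIS_le (t : nat) : (t <= K)%N ->
  R_DIS R H r t <= Num.min (H%:R / r%:R) t.+1%:R * (mn_load R K t / H%:R).
Proof.
move=> tK; set m := Num.min _ _.
have H0 : (0 < H)%N by exact: leq_trans r_le.
have m1 : 1 <= m.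
  by rewrite le_min ler_pdivlMr ?ltr0n // mul1r ler_nat r_le ler1n.
have bound (J : {set user H r}) : J \in V2 H r t ->
    r%:R^-1 * #|[set h : 'I_H | usersOf r h :&: J != finset.set0]|%:R <= m.
  rewrite inE => /andP[/eqP Jt _].
  rewrite mulrC le_min ler_pM2r ?invr_gt0 ?ltr0n // ler_nat.
  rewrite -[X in (_ <= X)%N]card_ord max_card /=.
  rewrite ler_pdivrMr ?ltr0n // -natrM ler_nat.
  have -> : (t.+1 * r = \sum_(k in J) #|val k|)%N.
    rewrite -Jt -sum_nat_const; apply: eq_bigr => k _.
    by apply/esym/eqP; exact: (valP k).
  have -> : (\sum_(k in J) #|val k| =
             \sum_(h : 'I_H) \sum_(k in J) (h \in val k))%N.
    rewrite exchange_big; apply: eq_bigr => k _.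
    by rewrite -sum1_card big_mkcond; apply: eq_bigr => h _; case: ifP.
  rewrite -sum1_card big_mkcond leq_sum // => h _; rewrite inE.
  case: ifP => // /finset.set0Pn[k]; rewrite !inE => /andP[hk kJ].
  by rewrite (bigD1 k) //= hk.
rewrite /R_DIS -[_ * 'C(_, t)%:R]mulrC invfM mulrA -(mn_load_binom R tK).
rewrite !mulrA ler_pM2r ?invr_gt0 ?ltr0n // ler_pM2r; last first.
  by rewrite invr_gt0 ltr0n bin_gt0.
have -> : 'C(K, t.+1)%:R = (#|V1 H r t| + #|V2 H r t|)%:R :> R.
  rewrite -card_user -card_draws -(cardsID [set J | relaysOf J != finset.set0]).
  by congr (_ + _)%:R; apply: eq_card => J; rewrite !inE ?negbK // andbC.
rewrite natrD mulrDr lerD ?ler_peMl //.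
by rewrite mulr_natr -sumr_const ler_sum.
Qed.

(** Any relay of any user of [J] serves that user, hence misses at most [t] of the [t + 1] users of
    [J]. *)
Lemma R_CICS_le (t : nat) : (t <= K)%N ->
  R_CICS R H r t <= (1 + t%:R / r%:R) * (mn_load R K t / H%:R).
Proof.
move=> tK; rewrite /R_CICS -(mn_load_binom R tK) -mulr_suml.
rewrite -(mulrA 'C(K, t.+1)%:R) -invfM mulrA [_%:R * H%:R]mulrC.
rewrite ler_wpM2r ?invr_ge0 -?natrM //.
rewrite mulr_natr -card_user -card_draws -sumr_const.
rewrite [X in _ <= X](eq_bigl (fun J : {set user H r} => #|J| == t.+1)); last first.
  by move=> J; rewrite inE.
rewrite ler_sum // => J /eqP Jt.
rewrite lerD2l ler_pM2r ?invr_gt0 ?ltr0n // ler_nat.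
have /card_gt0P[k kJ] : (0 < #|J|)%N by rewrite Jt.
have /card_gt0P[h hk] : (0 < #|val k|)%N by rewrite (eqP (valP k)).
apply: leq_trans (leq_bigmin_seq _ _ (mem_index_enum h)) _.
rewrite -ltnS -Jt -(cardsID (usersOf r h) J) -[X in (X < _)%N]add0n ltn_add2r.
by apply/card_gt0P; exists k; rewrite !inE kJ.
Qed.

Lemma R_IES_le : (2 * r < H)%N ->
  R_IES R H r <= 2 * r%:R / (2 * r%:R - 1) * (mn_load R K 1 / H%:R).
Proof.
move=> rH.
have r1 : 1 <= r%:R :> R by rewrite ler1n.
have H1 : 1 <= H%:R :> R by rewrite ler1n; lia.
have K0 : 0 < K%:R :> R by rewrite ltr0n bin_gt0.
(* The number of users sharing no relay with a given user, hence at most [K - 1]. By [absorb], the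
   second term of [R_IES] is [r * c / ((2 * r - 1) * H)], and the gap in the claim is then a
   positive multiple of [K - 1 - c]. *)
pose c : R := 'C(H - r, r)%:R.
have absorb : 'C((2 * r - 1)%N, (r - 1)%N)%:R * 'C((H - 1)%N, (2 * r - 1)%N)%:R
    = r%:R * K%:R / H%:R * c :> R.
  rewrite [LHS]mulrC -[LHS]natrM bin_mul_bin; last by lia.
  have -> : (H - 1 - (r - 1) = H - r)%N by lia.
  have -> : (2 * r - 1 - (r - 1) = r)%N by lia.
  have := mul_bin_diag H r.-1; rewrite prednK // -subn1 -subn1.
  move=> /(congr1 (@GRing.natmul R 1)).
  rewrite natrM natrM natrM => <-.
  by rewrite /c; field; lra.
have c_le : c <= K%:R - 1.
  rewrite lerBrDr natr1 ler_nat /K.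
  have [H' H'E] : exists H', H = H'.+1 by exists H.-1; lia.
  rewrite H'E -(prednK r_gt0) binS prednK // -addn1 leq_add //.
    by apply: leq_bin2l; lia.
  by rewrite bin_gt0; lia.
rewrite /R_IES -/K -/c mulrAC absorb /mn_load.
rewrite -subr_ge0 [X in 0 <= X](_ : _ =
   (K%:R - 1 - c) / ((2 * r%:R - 1) * (2 * H%:R))).
  by rewrite divr_ge0 ?subr_ge0 // mulr_ge0; lra.
by field; lra.
Qed.

End SchemeLoads.

(** * Orders of the users *)

Lemma card_perm_all (T : finType) : #|{: {perm T}}| = (#|T| `!)%N.
Proof.
have := card_perm [set: T]; rewrite cardsT => <-.
apply: eq_card => s; rewrite !unfold_in; apply/esym/fintype.subsetP => i _.
by rewrite inE.
Qed.

(* By symmetry every element of [S] comes first equally often, and in every order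
   some element of [S] comes first. *)
Lemma leq_card_perm_first (T : finType) (S : {set T}) (k : T) : k \in S ->
  (#|T| `! <= #|S| * #|[set s : {perm T} |
     [forall i in S, enum_rank (s k) <= enum_rank (s i)]]|)%N.
Proof.
move=> kS; pose first j := [set s : {perm T} |
  [forall i in S, enum_rank (s j) <= enum_rank (s i)]%N].
have card_first j : j \in S -> (#|first j| <= #|first k|)%N.
  move=> jS; rewrite -(card_imset _ (mulgI (tperm j k))) subset_leq_card //.
  apply/fintype.subsetP => y /imsetP[s + ->{y}]; rewrite !inE => /forall_inP s_first.
  apply/forall_inP => i iS; rewrite !permM tpermR s_first //.
  by case: tpermP => // ->.
have -> := esym (card_perm_all T).
rewrite -/(first k) -sum_nat_const.
apply: (@leq_trans (\sum_(j in S) #|first j|)%N); last first.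
  exact: leq_sum.
have -> : (\sum_(j in S) #|first j| =
           \sum_(s : {perm T}) \sum_(j in S) (s \in first j))%N.
  rewrite exchange_big; apply: eq_bigr => j _.
  by rewrite -sum1_card big_mkcond; apply: eq_bigr => s _; case: ifP.
rewrite -sum1_card (eq_bigl predT) // leq_sum // => s _.
case: (@arg_minnP T k (mem S) (fun i => enum_rank (s i)) kS) => j jS j_min.
rewrite (bigD1 j) //= inE.
have -> : [forall i in S, enum_rank (s j) <= enum_rank (s i)]%N.
  by apply/forall_inP => i /j_min.
exact: leq_addr.
Qed.

(** The load counts a relay only through its users, so bounding [relay_bits] requires each relay to
    have one. The witness is the set of the first [r] relays after swapping relay 0 with [h]. *)
Lemma usersOf_neq0 (H r : nat) (h : 'I_H) : (0 < r <= H)%N ->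
  exists k : user H r, k \in usersOf r h.
Proof.
case: r => // r /andP[_ rH].
pose f (i : 'I_r.+1) := tperm (widen_ord rH ord0) h (widen_ord rH i).
have f_inj : injective f by move=> i j /perm_inj /(congr1 val) /= /val_inj.
have fr : #|[set f i | i in 'I_r.+1]| == r.+1.
  by rewrite card_imset // card_ord.
exists (exist (fun A : {set 'I_H} => #|A| == r.+1) _ fr); rewrite inE /=.
by apply/imsetP; exists ord0; rewrite // /f tpermL.
Qed.

(** * Counting fresh bits for one demand and one order *)

Section CutSet.
Context (H r N B : nat) (S : scheme H r N B).
Hypotheses (r_gt0 : (0 < r)%N) (r_le : (r <= H)%N).

Definition bit (F : files N B) (p : 'I_N * 'I_B) : bool := tnth (F p.1) p.2.

Lemma uncoded_cached : uncoded S ->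
  exists C : user H r -> {set 'I_N * 'I_B},
    (forall k, #|C k| <= cache_bits S k)%N /\
    (forall k F F', {in C k, bit F =1 bit F'} -> cache S k F = cache S k F').
Proof.
move=> uncS.
have /choice[c cP] : forall kj : {k : user H r & 'I_(cache_bits S k)},
    exists p, forall F, tnth (cache S (tag kj) F) (tagged kj) = bit F p.
  by case=> k j; have [i [b ib]] := uncS k j; exists (i, b).
exists (fun k => [set c (Tagged _ j) | j : 'I_(cache_bits S k)]); split=> k.
  by rewrite -[X in (_ <= X)%N]card_ord leq_imset_card.
move=> F F' FF'; apply: eq_from_tnth => j.
by rewrite !(cP (Tagged _ j)) FF' // imset_f.
Qed.

Definition max_bits : nat :=
  \max_(d : demand H r N) \max_(h < H) \max_(k in usersOf r h)
     maxn (relay_bits S d h) (link_bits S d h k).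

Lemma relay_bits_le (d : demand H r N) (h : 'I_H) :
  (relay_bits S d h <= max_bits)%N.
Proof.
have [|k kh] := @usersOf_neq0 H r h; first by rewrite r_gt0.
apply: (@bigop.bigmax_sup _ d) => //.
apply: (@bigop.bigmax_sup _ h) => //.
by apply: (@bigop.bigmax_sup _ k) => //; exact: leq_maxl.
Qed.

Context (C : user H r -> {set 'I_N * 'I_B}).
Hypothesis cacheC :
  forall k F F', {in C k, bit F =1 bit F'} -> cache S k F = cache S k F'.

(** The strict inequality, read at [i = k], also forbids [k] itself from having cached [p]. *)
Definition fresh (d : demand H r N) (rk : user H r -> nat) :
    {set 'I_N * 'I_B} :=
  [set p | [exists k, (d k == p.1) &&
                      [forall i, (p \in C i) ==> (rk k < rk i)%N]]].

(* The users recover their files one after the other: what a user has cached is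
   either not fresh or belongs to a file already recovered. *)
Lemma fresh_determined (d : demand H r N) (rk : user H r -> nat)
    (F F' : files N B) :
  (forall k, decoded S d F k = F (d k)) ->
  (forall k, decoded S d F' k = F' (d k)) ->
  (forall h, relay_msg S d h F = relay_msg S d h F') ->
  (forall p, p \notin fresh d rk -> bit F p = bit F' p) ->
  F = F'.
Proof.
move=> decF decF' msgFF' bitFF'.
have known n k : (rk k < n)%N -> F (d k) = F' (d k).
  elim: n k => // n IHn k; rewrite ltnS => rk_k.
  rewrite -decF -decF' /decoded (cacheC (F' := F')); last first.
    move=> p pk; have [|/bitFF'//] := boolP (p \in fresh d rk).
    rewrite inE => /existsP[j /andP[/eqP dj /forallP/(_ k)]].
    by rewrite pk /= /bit -dj => jk; rewrite (IHn j) // (leq_trans jk).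
  congr (@Defs.decode _ _ _ _ S d k _ _); apply: functional_extensionality_dep => h.
  by apply: functional_extensionality_dep => _; rewrite msgFF'.
apply/ffunP => i; apply: eq_from_tnth => b.
have [|/bitFF'//] := boolP ((i, b) \in fresh d rk).
rewrite inE => /existsP[j /andP[/eqP /= <- _]].
by rewrite (known (rk j).+1).
Qed.

Lemma card_files : #|{: files N B}| = (2 ^ #|{: 'I_N * 'I_B}|)%N.
Proof.
by rewrite /files card_ffun card_tuple card_bool card_prod !card_ord -expnM mulnC.
Qed.

(** At least half of the file vectors are decoded correctly, and on these the relay messages with
    the non-fresh bits form an injective code. The lost half is the final [+ 1]. *)
Lemma card_fresh_le (R : realType) (d : demand H r N) (rk : user H r -> nat) :
  error_prob R S <= 2^-1 -> (#|fresh d rk| <= H * max_bits + 1)%N.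
Proof.
move=> err; set A := fresh d rk.
pose bad := [set F : files N B | [exists k, decoded S d F k != F (d k)]].
have bad_le : (#|bad| * 2 <= #|{: files N B}|)%N.
  have files_gt0 : (0 < #|{: files N B}|)%N by rewrite card_files expn_gt0.
  have : #|bad|%:R / #|{: files N B}|%:R <= 2^-1 :> R.
    apply: le_trans err.
    exact: (le_bigmax _ (fun d => #|[set F : files N B |
      [exists k, decoded S d F k != F (d k)]]|%:R / #|{: files N B}|%:R) d).
  rewrite ler_pdivrMr ?ltr0n // ler_pdivlMl ?ltr0n //.
  by rewrite mulrC -natrM ler_nat.
(* Messages are padded with [false] to [max_bits]. Their lengths depend on [d] and [h] but not on
   [F], so padding loses no information. *)
pose enc (F : files N B) : {ffun 'I_H * 'I_max_bits + {p | p \notin A} -> bool} :=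
  [ffun x : ('I_H * 'I_max_bits + {p | p \notin A})%type =>
     match x with
     | inl (h, i) => nth false (relay_msg S d h F) i
     | inr p => bit F (sval p)
     end].
have enc_inj : {in ~: bad &, injective enc}.
  have good F : F \in ~: bad -> forall k, decoded S d F k = F (d k).
    by rewrite !inE negb_exists => /forallP goodF k; have /negPn/eqP := goodF k.
  move=> F F' /good gF /good gF' /ffunP encFF'.
  apply: (fresh_determined (d := d) (rk := rk)) => // [h | p pA].
    apply: eq_from_tnth => i.
    have im : (i < max_bits)%N := leq_trans (ltn_ord i) (relay_bits_le d h).
    have := encFF' (inl (h, Ordinal im)); rewrite !ffunE /=.
    by rewrite !(tnth_nth false).
  by have := encFF' (inr (exist _ p pA)); rewrite !ffunE.
have := max_card [set enc F | F in ~: bad].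
rewrite card_in_imset // card_ffun card_bool card_sum card_prod !card_ord card_sig.
move=> good_le.
have Af : (#|[pred p | p \notin A]| + #|A| = #|{: 'I_N * 'I_B}|)%N.
  by rewrite addnC -(cardC (mem A)).
have bad_good : (#|bad| + #|~: bad| = #|{: files N B}|)%N := cardsC bad.
have : (2 ^ #|{: 'I_N * 'I_B}| <= 2 ^ (H * max_bits + #|[pred p | p \notin A]| + 1))%N.
  rewrite addn1 expnS -card_files; move: bad_le good_le bad_good; lia.
by rewrite leq_exp2l // -Af; lia.
Qed.

End CutSet.

(** * Averaging over cyclic shifts and orders *)

Section Averaging.
Context (R : realType) (H r n B : nat) (S : scheme H r n.+1 B).
Hypotheses (r_gt0 : (0 < r)%N) (r_le : (r <= H)%N).
Hypothesis le_users : (#|{: user H r}| <= n.+1)%N.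
Context (C : user H r -> {set 'I_n.+1 * 'I_B}).
Hypothesis cacheC :
  forall k F F', {in C k, bit F =1 bit F'} -> cache S k F = cache S k F'.
Let K := #|{: user H r}|.

(** The number of files is written [n.+1] so that [+] on indices is addition modulo the number of
    files. *)
Definition cyclic_demand (s : 'I_n.+1) : demand H r n.+1 :=
  [ffun k => widen_ord le_users (enum_rank k) + s].

Lemma cyclic_demand_inj (s : 'I_n.+1) : injective (cyclic_demand s).
Proof.
move=> k k'; rewrite !ffunE => /addIr /(congr1 val) /= /val_inj.
exact: enum_rank_inj.
Qed.

Lemma sum_cyclic_demand (k : user H r) (i : 'I_n.+1) :
  (\sum_s (cyclic_demand s k == i) = 1)%N.
Proof.
rewrite (bigD1 (i - widen_ord le_users (enum_rank k))) //= big1 => [|s].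
  by rewrite ffunE addrC subrK eqxx.
by rewrite ffunE; apply: contraNeq; rewrite -lt0n lt0b => /eqP <-; rewrite addrC addKr.
Qed.

Definition cached_by (p : 'I_n.+1 * 'I_B) : {set user H r} :=
  [set k | p \in C k].

(** The part of [fresh] that does not involve the demand: it is averaged over orders, the demand
    over shifts. *)
Definition precedes (rk : user H r -> nat) (k : user H r)
    (p : 'I_n.+1 * 'I_B) : bool :=
  [forall i, (p \in C i) ==> (rk k < rk i)%N].

(** For distinct demands at most one user asks for the file of [p], so the inner sum never exceeds
    1. *)
Lemma card_fresh_ge (d : demand H r n.+1) (rk : user H r -> nat) :
  injective d ->
  (\sum_p \sum_k (d k == p.1) * precedes rk k p <= #|fresh C d rk|)%N.
Proof.
move=> d_inj; rewrite -sum1_card [leqRHS]big_mkcond leq_sum //= => p _.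
rewrite inE; case: ifPn => [/existsP[k /andP[/eqP dk _]] | /existsPn no_k].
  rewrite (bigD1 k) //= [X in (_ + X)%N]big1 ?addn0 => [|j jk].
    by case: eqP; case: precedes.
  by rewrite -dk (inj_eq d_inj) (negPf jk).
by rewrite big1 // => k _; have /negPf := no_k k; rewrite mulnb => ->.
Qed.

(** [k] has to come first among itself and the users that cached [p]. *)
Lemma card_perm_precedes (k : user H r) (p : 'I_n.+1 * 'I_B) :
  k \notin cached_by p ->
  (K `! <= #|cached_by p|.+1 *
    \sum_(s : {perm user H r}) precedes (fun i => enum_rank (s i)) k p)%N.
Proof.
move=> kp.
apply: leq_trans (leq_card_perm_first (finset.setU11 k (cached_by p))) _.
rewrite cardsU1 kp add1n leq_mul2l /= -sum1_card big_mkcond leq_sum // => s _.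
rewrite inE; case: ifPn => // /forall_inP s_first; rewrite lt0b.
apply/forallP => i; apply/implyP => ip.
rewrite ltn_neqAle s_first ?andbT ?inE ?ip ?orbT //.
apply: contraNneq kp => /val_inj /enum_rank_inj /perm_inj ->.
by rewrite inE.
Qed.

(** Count fresh bits over all [n + 1] shifts and [K!] orders. If [c] users cached [p], each of the
    other [K - c] users demands its file in exactly one shift and precedes those [c] in at least
    [K! / (c + 1)] orders: in total at least [K!] times [mn_load c]. *)
Lemma sum_mn_load_le : error_prob R S <= 2^-1 ->
  \sum_p mn_load R K #|cached_by p| <= n.+1%:R * (H%:R * (max_bits S)%:R + 1).
Proof.
move=> err.
have fact_gt0 : 0 < (K `!)%:R :> R by rewrite ltr0n fact_gt0.
rewrite -(ler_pM2l fact_gt0) mulr_sumr.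
pose rk (s : {perm user H r}) k : nat := enum_rank (s k).
apply: (@le_trans _ _ (\sum_(d : 'I_n.+1) \sum_(s : {perm user H r})
    #|fresh C (cyclic_demand d) (rk s)|)%:R); last first.
  rewrite mulrCA -natrM natr1 -!natrM ler_nat -[(H * _).+1]addn1.
  have <- : (\sum_(d : 'I_n.+1) \sum_(s : {perm user H r}) (H * max_bits S + 1) =
             n.+1 * (K `! * (H * max_bits S + 1)))%N.
    by rewrite !sum_nat_const card_ord card_perm_all.
  do 2! [apply: leq_sum => ? _]; exact: card_fresh_le err.
apply: (@le_trans _ _ (\sum_p \sum_k
    \sum_(s : {perm user H r}) precedes (rk s) k p)%:R).
  rewrite natr_sum ler_sum // => p _.
  rewrite (bigID (mem (cached_by p))) /= natrD -[leLHS]add0r lerD //.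
  have -> : (K `!)%:R * mn_load R K #|cached_by p| =
      \sum_(k | k \notin cached_by p) (K `!)%:R / #|cached_by p|.+1%:R.
    rewrite sumr_const /mn_load -natrB ?max_card //.
    have -> : (K - #|cached_by p| = #|[pred k | k \notin cached_by p]|)%N.
      by rewrite /K -(cardC (mem (cached_by p))) addKn.
    by rewrite -mulr_natr; ring.
  rewrite natr_sum ler_sum // => k kp.
  by rewrite ler_pdivrMr ?ltr0n // mulrC -natrM ler_nat card_perm_precedes.
rewrite ler_nat.
have -> : (\sum_p \sum_k \sum_(s : {perm user H r}) precedes (rk s) k p =
    \sum_(d : 'I_n.+1) \sum_(s : {perm user H r})
    \sum_p \sum_k (cyclic_demand d k == p.1) * precedes (rk s) k p)%N.
  under [RHS]eq_bigr do rewrite exchange_big.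
  rewrite [RHS]exchange_big; apply: eq_bigr => p _.
  under [RHS]eq_bigr do rewrite exchange_big.
  rewrite [RHS]exchange_big; apply: eq_bigr => k _ /=.
  under [RHS]eq_bigr do rewrite -big_distrr.
  by rewrite -big_distrl /= sum_cyclic_demand mul1n.
do 2! [apply: leq_sum => ? _].
exact: card_fresh_ge (@cyclic_demand_inj _).
Qed.

Lemma sum_cached_by : (\sum_p #|cached_by p| = \sum_k #|C k|)%N.
Proof.
under eq_bigr do rewrite -sum1_card big_mkcond.
rewrite exchange_big; apply: eq_bigr => k _.
by rewrite -sum1_card [RHS]big_mkcond; apply: eq_bigr => p _; rewrite inE.
Qed.

End Averaging.

(* A chord of [mn_load] is affine, non-increasing, and below [mn_load] at every
   integer, so only the total amount of cached bits matters. *)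
Lemma mn_chord_le_load (R : realType) (H r N B : nat) (S : scheme H r N B)
    (M : R) (m : nat) :
  (0 < r)%N -> (r <= H)%N -> ('C(H, r) <= N)%N -> (0 < B)%N -> uncoded S ->
  (forall k, (cache_bits S k)%:R <= M * B%:R) -> error_prob R S <= 2^-1 ->
  mn_chord 'C(H, r) m ('C(H, r)%:R * M / N%:R) <=
  H%:R * max_link_load R S + B%:R^-1.
Proof.
move=> r_gt0 r_le; rewrite -(card_user H r).
set K := #|_|; case: N S => [|n] {}S le_users B_gt0 uncS cacheM err.
  by rewrite leqNgt /K (card_user H r) bin_gt0 r_le in le_users.
have [C [C_le cacheC]] := uncoded_cached uncS.
have B0 : 0 < B%:R :> R by rewrite ltr0n.
have n0 : 0 < n.+1%:R :> R by rewrite ltr0n.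
have cached_le : \sum_p #|cached_by C p|%:R <= K%:R * (M * B%:R).
  rewrite -natr_sum sum_cached_by natr_sum mulr_natl -sumr_const ler_sum // => k _.
  by apply: le_trans (cacheM k); rewrite ler_nat.
have := sum_mn_load_le r_gt0 r_le le_users cacheC err.
rewrite -/K => load_le.
have : n.+1%:R * B%:R * mn_chord K m (K%:R * M / n.+1%:R) <=
    n.+1%:R * (H%:R * (max_bits S)%:R + 1).
  apply: le_trans load_le.
  apply: (@le_trans _ _ (\sum_p mn_chord K m #|cached_by C p|%:R)); last first.
    by apply: ler_sum => p _; exact: mn_chord_le.
  have -> : \sum_p mn_chord K m #|cached_by C p|%:R =
      n.+1%:R * B%:R * (mn_load R K m - m%:R * mn_slope R K m) +
      (\sum_p #|cached_by C p|%:R) * mn_slope R K m.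
    have card_bits : #|{: 'I_n.+1 * 'I_B}| = (n.+1 * B)%N.
      by rewrite card_prod !card_ord.
    rewrite -natrM -card_bits mulr_natl -sumr_const mulr_suml -big_split /=.
    by apply: eq_bigr => p _; rewrite /mn_chord; ring.
  rewrite -subr_ge0 [X in 0 <= X](_ : _ =
     (K%:R * (M * B%:R) - \sum_p #|cached_by C p|%:R) * - mn_slope R K m).
    by rewrite mulr_ge0 ?subr_ge0 // oppr_ge0 mn_slope_le0.
  by rewrite /mn_chord; field; rewrite addrC natr1 pnatr_eq0.
rewrite -mulrA ler_pM2l // mulrC -ler_pdivlMr // => /le_trans; apply.
by rewrite mulrDl mul1r lerD2r -mulrA.
Qed.

(** * Passing to the limit in the file size *)

Lemma limn_esup_ge (R : realType) (u : nat -> \bar R) (c : \bar R) :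
  (\forall n \near \oo%classic, (c <= u n)%E) -> (c <= limn_esup u)%E.
Proof.
move=> c_le; apply: le_ereal_inf_tmp => _ [V V_oo <-].
have [n [Vn cn]] : exists n, V n /\ (c <= u n)%E.
  have /filter_ex[n [Vn cn]] : (\forall n \near \oo%classic, V n /\ (c <= u n)%E).
    by near=> n; split; near: n.
  by exists n.
by apply: le_trans cn _; apply: ereal_sup_ubound; exists n.
Unshelve. all: by end_near.
Qed.

Lemma limn_esup_le (R : realType) (u : nat -> \bar R) (c : \bar R) :
  (forall n, (u n <= c)%E) -> (limn_esup u <= c)%E.
Proof.
move=> u_le; apply: (@le_trans _ _ (ereal_sup [set u n | n in setT]%classic)).
  by apply: ereal_inf_lbound; exists setT => //; exact: filterT.
by apply: ge_ereal_sup => _ [n _ <-].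
Qed.

Lemma mn_chord_le_achievable (R : realType) (H r N m : nat) (M L : R) :
  (0 < r)%N -> (r <= H)%N -> ('C(H, r) <= N)%N ->
  achievable_uncoded H r N M L ->
  mn_chord 'C(H, r) m ('C(H, r)%:R * M / N%:R) / H%:R <= L.
Proof.
move=> r_gt0 r_le le_users [B [S [B_oo uncS cacheM err load_le]]].
have H_gt0 : 0 < H%:R :> R by rewrite ltr0n (leq_trans r_gt0).
apply/ler_addgt0Pl => e e_gt0; rewrite -lerBlDl -lee_fin.
apply: le_trans load_le; apply: limn_esup_ge.
have half_gt0 : 0 < 2^-1 :> R by rewrite invr_gt0.
move/cvgr0Pnorm_lt: err => /(_ _ half_gt0) err_lt.
move/cvgnyPgt: B_oo => B_oo.
near=> n.
(* This gives [1 / B n <= e * H], so the bit paid for decoding errors costs at most [e] after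
   dividing by [H]. *)
have B_gt : (Num.truncn (e * H%:R)^-1 < B n)%N by near: n; exact: B_oo.
have B_gt0 : (0 < B n)%N by exact: leq_ltn_trans B_gt.
have err_n : error_prob R (S n) <= 2^-1.
  by apply: le_trans (ler_norm _) _; apply: ltW; near: n.
have := mn_chord_le_load m r_gt0 r_le le_users B_gt0 (uncS n) (cacheM n) err_n.
rewrite lee_fin lerBlDr ler_pdivrMr // mulrDl [_ * H%:R]mulrC => /le_trans; apply.
rewrite lerD2l invf_ple ?posrE ?ltr0n ?mulr_gt0 //.
have eH0 : 0 <= (e * H%:R)^-1 by rewrite invr_ge0 ltW // mulr_gt0.
have /andP[_ /ltW /le_trans] := truncn_itv eH0; apply.
by rewrite ler_nat.
Unshelve. all: by end_near.
Qed.

(** Bounding the infimum [Rstar_u] from below requires some achievable load. Here caches are empty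
    and every link carries all the files. *)
Lemma achievable_uncoded_nonempty (R : realType) (H r N : nat) (M : R) :
  (0 < r)%N -> 0 <= M -> achievable_uncoded H r N M N%:R.
Proof.
move=> r_gt0 M_ge0.
have relay_of (k : user H r) : {h : 'I_H | h \in val k}.
  apply/sigW; have /card_gt0P[h hk] : (0 < #|val k|)%N by rewrite (eqP (valP k)).
  by exists h.
pose flood B : scheme H r N B := @Scheme H r N B
  (fun=> 0%N) (fun _ _ => [tuple])
  (fun _ _ => #|{: 'I_N * 'I_B}|)
  (fun _ _ F => [tuple bit F (enum_val j) | j < #|{: 'I_N * 'I_B}|])
  (fun _ _ _ => #|{: 'I_N * 'I_B}|)
  (fun _ _ _ => id)
  (fun d k _ link => let h := relay_of k in
     [tuple tnth (link (sval h) (svalP h)) (enum_rank (d k, b)) | b < B]).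
have decodes B d F k : decoded (flood B) d F k = F (d k).
  by apply: eq_from_tnth => b; rewrite /decoded /= !tnth_mktuple enum_rankK.
exists id, flood; split => //.
- by move=> B k [].
- by move=> B k; rewrite mulr_ge0.
- rewrite (_ : (fun i => _) = fun=> 0); first exact: cvg_cst.
  apply/funext => B; rewrite /error_prob.
  apply: big1_idem => [|d _]; first exact: maxxx.
  rewrite (_ : [set F | _] = finset.set0) ?cards0 ?mul0r //.
  apply/setP => F; rewrite !inE; apply/negbTE/existsPn => k.
  by rewrite decodes eqxx.
- apply: limn_esup_le => B; rewrite lee_fin /max_link_load.
  (* The sequence starts at file size 0, where division by zero makes the load 0. *)
  case: B => [|B]; first by rewrite invr0 mulr0.
  rewrite ler_pdivrMr ?ltr0n // -natrM ler_nat.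
  do 3! (apply/bigmax_leqP => ? _).
  by rewrite /= maxnn card_prod !card_ord.
Qed.

Lemma le_Rstar_u (R : realType) (H r N m : nat) (M : R) :
  (0 < r)%N -> (r <= H)%N -> ('C(H, r) <= N)%N -> 0 <= M ->
  mn_chord 'C(H, r) m ('C(H, r)%:R * M / N%:R) / H%:R <= Rstar_u H r N M.
Proof.
move=> r_gt0 r_le le_users M_ge0; apply: lb_le_inf.
  by exists N%:R; exact: achievable_uncoded_nonempty.
by move=> L; exact: mn_chord_le_achievable.
Qed.

(** * From integer points to arbitrary memory *)

Lemma mn_load_ge0 (R : realType) (K c : nat) : (c <= K)%N -> 0 <= mn_load R K c.
Proof. by move=> cK; rewrite divr_ge0 // subr_ge0 ler_nat. Qed.

Lemma mn_chord_ge0 (R : realType) (K m : nat) (t : R) :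
  (m < K)%N -> m%:R <= t <= m.+1%:R -> 0 <= mn_chord K m t.
Proof.
move=> mK /andP[mt tm].
have -> : mn_chord K m t =
    (m.+1%:R - t) * mn_load R K m + (t - m%:R) * mn_load R K m.+1.
  by rewrite /mn_chord /mn_slope -[m.+1%:R]natr1; ring.
by rewrite addr_ge0 // mulr_ge0 ?subr_ge0 // mn_load_ge0 // ltnW.
Qed.

(** Both sides mix two points with the same weights. The bound at [j] is asked only for [m < t]: at
    [t = m] the weight of [j] vanishes, and a factor built from the ceiling of [t] need not cover
    [m + 1]. *)
Lemma lower_envelope_le_mn_chord (R : realType) (I : finType) (px py : I -> R)
    (i j : I) (K m : nat) (x t g : R) :
  m%:R <= t <= m.+1%:R -> px i + (t - m%:R) * (px j - px i) = x ->
  py i <= g * mn_load R K m -> (m%:R < t -> py j <= g * mn_load R K m.+1) ->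
  lower_envelope px py x <= g * mn_chord K m t.
Proof.
move=> /andP[mt tm] <- le_i le_j.
have a01 : 0 <= t - m%:R <= 1.
  by rewrite subr_ge0 mt lerBlDl natr1.
apply: le_trans (lower_envelope_le2 _ _ _ _ a01) _.
rewrite [X in X <= _](_ : _ = (m.+1%:R - t) * py i + (t - m%:R) * py j); last first.
  by rewrite -natr1; ring.
rewrite [X in _ <= X](_ : _ = (m.+1%:R - t) * (g * mn_load R K m) +
    (t - m%:R) * (g * mn_load R K m.+1)); last first.
  by rewrite /mn_chord /mn_slope -[m.+1%:R]natr1; ring.
apply: lerD; first by rewrite ler_wpM2l ?subr_ge0.
move: mt; rewrite le_eqVlt => /predU1P[-> | lt_mt]; first by rewrite subrr !mul0r.
by rewrite ler_wpM2l ?subr_ge0 ?le_j // ltW.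
Qed.

Section Bounds.
Context (R : realType) (H r N : nat) (M : R).
Hypotheses (r_gt0 : (0 < r)%N) (r_le : (r <= H)%N).
Hypotheses (le_users : ('C(H, r) <= N)%N).
Let K := 'C(H, r).
Let H_gt0 : 0 < H%:R :> R. Proof. by rewrite ltr0n (leq_trans r_gt0). Qed.
Let K_gt0 : (0 < K)%N. Proof. by rewrite bin_gt0. Qed.
Let KR_gt0 : 0 < K%:R :> R. Proof. by rewrite ltr0n. Qed.
Let N_gt0 : 0 < N%:R :> R. Proof. by rewrite ltr0n (leq_trans K_gt0). Qed.

Context (m : nat) (t : R).
Hypotheses (mK : (m < K)%N) (mt : m%:R <= t <= m.+1%:R).
Hypothesis M_eq : M = N%:R * t / K%:R.
Let i : 'I_K.+1 := Ordinal (ltnW mK : (m < K.+1)%N).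
Let j : 'I_K.+1 := Ordinal (mK : (m.+1 < K.+1)%N).

Lemma mem_point_interp :
  mem_point R H r N i + (t - m%:R) * (mem_point R H r N j - mem_point R H r N i)
  = M.
Proof.
rewrite M_eq /mem_point -/K -[j%:R]natr1.
by field; rewrite gt_eqF.
Qed.

Lemma le_ceil_nat : m%:R <= (Num.ceil t)%:~R :> R.
Proof. by have /andP[/le_trans le_t _] := mt; rewrite le_t // ceil_ge. Qed.

Lemma lt_ceil_nat : m%:R < t -> m.+1%:R <= (Num.ceil t)%:~R :> R.
Proof.
move=> lt_mt; have : m%:Z < Num.ceil t by rewrite ltNge ceil_le_int -ltNge.
by rewrite -lezD1 -(ler_int R) intrD natr1.
Qed.

(** In the term [x = H], [K <= N] makes the subtracted binomial vanish, so its points are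
    [mn_load c / H], all above the affine chord. *)
Lemma mn_chord_le_Rcut : mn_chord K m t / H%:R <= Rcut H r N M.
Proof.
apply: (@le_trans _ _ (rho r N H M)); last first.
  apply: (le_bigmax_seq (rho r N r M) H predT (fun x => rho r N x M)) => //.
  by rewrite mem_index_iota r_le ltnSn.
have -> : mn_chord K m t / H%:R = (mn_load R K m - m%:R * mn_slope R K m) / H%:R
    + mn_slope R K m * K%:R / (N%:R * H%:R) * M.
  by rewrite M_eq /mn_chord; field; rewrite !gt_eqF.
apply: lower_envelope_ge => [|c].
  have a01 : 0 <= t - m%:R <= 1.
    by have /andP[? ?] := mt; rewrite subr_ge0 lerBlDl natr1; apply/andP.
  rewrite (_ : M = m%:R * (N%:R / K%:R) + (t - m%:R) *
      (m.+1%:R * (N%:R / K%:R) - m%:R * (N%:R / K%:R))).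
    by eexists; exact: (mixture2 _ _ i j a01).
  by rewrite M_eq -natr1; field; rewrite gt_eqF.
have -> : ('C(H, r) - N = 0)%N by apply/eqP.
rewrite bin0n subr0 mn_load_binom; last by rewrite -ltnS.
rewrite [X in X <= _](_ : _ = H%:R^-1 * mn_chord K m c%:R).
  by rewrite ler_pM2l ?invr_gt0 // mn_chord_le.
by rewrite /mn_chord; field; rewrite !gt_eqF.
Qed.

Lemma load_DIS_base_le : load_DIS_base H r N M <=
  Num.min (H%:R / r%:R) ((Num.ceil t)%:~R + 1) * (mn_chord K m t / H%:R).
Proof.
have R_le (c : nat) : (c <= K)%N -> c%:R <= (Num.ceil t)%:~R :> R ->
    R_DIS R H r c <=
    Num.min (H%:R / r%:R) ((Num.ceil t)%:~R + 1) / H%:R * mn_load R K c.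
  move=> cK c_le; apply: le_trans (R_DIS_le R r_gt0 r_le cK) _.
  rewrite [leRHS]mulrAC -[leRHS]mulrA ler_wpM2r //.
    by rewrite divr_ge0 // mn_load_ge0.
  by rewrite le_min ge_min lexx ge_min -natr1 lerD2r c_le orbT.
rewrite mulrCA mulrC.
apply: (lower_envelope_le_mn_chord (i := inl i) (j := inl j)) => //.
- exact: mem_point_interp.
- by apply: R_le => //; [exact: ltnW | exact: le_ceil_nat].
- by move=> lt_mt; apply: R_le => //; exact: lt_ceil_nat.
Qed.

Lemma load_CICS_le : load_CICS H r N M <=
  (1 + (Num.ceil t)%:~R / r%:R) * (mn_chord K m t / H%:R).
Proof.
have R_le (c : nat) : (c <= K)%N -> c%:R <= (Num.ceil t)%:~R :> R ->
    R_CICS R H r c <= (1 + (Num.ceil t)%:~R / r%:R) / H%:R * mn_load R K c.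
  move=> cK c_le; apply: le_trans (R_CICS_le R r_gt0 cK) _.
  rewrite [leRHS]mulrAC -[leRHS]mulrA ler_wpM2r //.
    by rewrite divr_ge0 // mn_load_ge0.
  by rewrite lerD2l ler_wpM2r.
rewrite mulrCA mulrC.
apply: (lower_envelope_le_mn_chord (i := i) (j := j)) => //.
- exact: mem_point_interp.
- by apply: R_le => //; [exact: ltnW | exact: le_ceil_nat].
- by move=> lt_mt; apply: R_le => //; exact: lt_ceil_nat.
Qed.

End Bounds.

Lemma load_IES_le (R : realType) (H r N : nat) (M t : R) :
  (0 < r)%N -> (2 * r < H)%N -> 0 <= t <= 1 -> M = N%:R * t / 'C(H, r)%:R ->
  load_IES H r N M <= 2 * r%:R / (2 * r%:R - 1) * (mn_chord 'C(H, r) 0 t / H%:R).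
Proof.
move=> r_gt0 rH t01 ->.
have r1 : 1 <= r%:R :> R by rewrite ler1n.
rewrite [_ / H%:R]mulrC mulrA.
apply: (lower_envelope_le_mn_chord (i := false) (j := true)) => //.
- by rewrite add0r !subr0; ring.
(* At [M = 0] the load [K / H] equals [mn_load 0 / H], and the factor is at least 1. *)
- rewrite [leRHS]mulrAC -[leRHS]mulrA /mn_load subr0 divr1 ler_peMl ?divr_ge0 //.
  by rewrite ler_pdivlMr; lra.
- move=> _; apply: le_trans (R_IES_le R r_gt0 _ rH) _; first by lia.
  by rewrite [leRHS]mulrAC mulrA.
Qed.

Theorem theorem7 (R : realType) (H r N : nat) (M : R)
    (hr : (1 <= r <= H)%N) (hN : ('C(H, r) <= N)%N)
    (hM : 0 <= M <= N%:R) :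
  [/\ forall t : R, 0 <= t <= 'C(H, r)%:R -> M = N%:R * t / 'C(H, r)%:R ->
        load_DIS_base H r N M <=
        Num.min (H%:R / r%:R) ((Num.ceil t)%:~R + 1) * Rcut H r N M,
      forall t : R, 0 <= t <= 'C(H, r)%:R -> M = t * N%:R / 'C(H, r)%:R ->
        load_CICS H r N M <= (1 + (Num.ceil t)%:~R / r%:R) * Rcut H r N M,
      M <= r%:R * N%:R / 'C(H, r)%:R ->
        load_CICS H r N M <= 2 * Rstar_u H r N M &
      (2 * r < H)%N -> M <= N%:R / 'C(H, r)%:R ->
      (exists p v : nat, [/\ prime p, (0 < v)%N & (2 * r - 1 = p ^ v)%N]) \/
      (exists p q : nat,
         [/\ prime p, prime q, p <> q & (2 * r - 1 = p * q)%N]) ->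
        load_IES H r N M <= 2 * r%:R / (2 * r%:R - 1) * Rstar_u H r N M /\
        2 * r%:R / (2 * r%:R - 1) <= 4 / 3 :> R].
Proof.
have /andP[r_gt0 r_le] := hr; have /andP[M_ge0 M_le] := hM.
have K_gt0 : (0 < 'C(H, r))%N by rewrite bin_gt0.
have KR_gt0 : 0 < 'C(H, r)%:R :> R by rewrite ltr0n.
have N_gt0 : 0 < N%:R :> R by rewrite ltr0n (leq_trans K_gt0).
have ceil_ge0 (t : R) : 0 <= t -> 0 <= (Num.ceil t)%:~R :> R.
  by move=> /le_trans -> //; exact: ceil_ge.
pose tM : R := 'C(H, r)%:R * M / N%:R.
have tM_ge0 : 0 <= tM by rewrite divr_ge0 // mulr_ge0.
have tM_le : tM <= 'C(H, r)%:R by rewrite ler_pdivrMr // ler_pM2l.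
have M_tM : M = N%:R * tM / 'C(H, r)%:R.
  by rewrite /tM; field; rewrite !gt_eqF.
split.
- move=> t t0K M_t; have /andP[t_ge0 _] := t0K.
  have [m [mK mt tm]] := unit_interval_exists K_gt0 t0K.
  have mtm : m%:R <= t <= m.+1%:R by apply/andP.
  apply: le_trans (load_DIS_base_le r_gt0 r_le mK mtm M_t) _.
  rewrite ler_wpM2l ?(mn_chord_le_Rcut r_gt0 r_le hN mK mtm M_t) //.
  by rewrite le_min divr_ge0 // addr_ge0 ?ceil_ge0.
- move=> t t0K; rewrite [t * _]mulrC => M_t; have /andP[t_ge0 _] := t0K.
  have [m [mK mt tm]] := unit_interval_exists K_gt0 t0K.
  have mtm : m%:R <= t <= m.+1%:R by apply/andP.
  apply: le_trans (load_CICS_le r_gt0 r_le mK mtm M_t) _.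
  rewrite ler_wpM2l ?(mn_chord_le_Rcut r_gt0 r_le hN mK mtm M_t) //.
  by rewrite addr_ge0 // divr_ge0 // ceil_ge0.
- rewrite ler_pdivlMr // => M_le_r.
  have tM_r : tM <= r%:R by rewrite ler_pdivrMr // mulrC.
  have [|m [mK mt tm]] := unit_interval_exists (t := tM) K_gt0.
    by apply/andP.
  have mtm : m%:R <= tM <= m.+1%:R by apply/andP.
  apply: le_trans (load_CICS_le r_gt0 r_le mK mtm M_tM) _.
  apply: (@le_trans _ _ (2 * (mn_chord 'C(H, r) m tM / H%:R))); last first.
    by rewrite ler_pM2l // le_Rstar_u.
  rewrite ler_wpM2r ?divr_ge0 ?mn_chord_ge0 //.
  (* As [r] is an integer, [tM <= r] survives rounding up, which brings the CICS factor down to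
     2. *)
  have : (Num.ceil tM)%:~R <= r%:R :> R by rewrite -[r%:R]/(r%:Z%:~R) ler_int ceil_le_int.
  rewrite -[2]/(1 + 1) lerD2l ler_pdivrMr ?ltr0n // mul1r; exact.
- move=> rH M_le1 prime_hyp.
  have tM_1 : tM <= 1.
    by rewrite ler_pdivrMr // mul1r mulrC -ler_pdivlMr.
  (* Either form of [2 * r - 1] exceeds 1, so [r >= 2]; the factor decreases in [r] and equals
     [4 / 3] at [r = 2]. *)
  have r_gt1 : (1 < r)%N.
    suff : (1 < 2 * r - 1)%N by lia.
    case: prime_hyp => [[p [v [/prime_gt1 p1 v0 ->]]] |
                        [p [q [/prime_gt1 p1 /prime_gt1 q1 _ ->]]]].
      by rewrite -(expn0 p) ltn_exp2l.
    by nia.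
  have r2 : 2 <= r%:R :> R by rewrite ler_nat.
  split; last by rewrite ler_pdivrMr; lra.
  apply: le_trans (load_IES_le r_gt0 rH _ M_tM) _; first by apply/andP.
  rewrite ler_wpM2l ?le_Rstar_u // divr_ge0 //; lra.
Qed.
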